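(* Let $X$ be a space and let $\mathfrak{P}$ be a closed hereditary topological property preserved under finite closed sums. Then $$C^{\mathfrak P}_0(X)=\{f\in C_B(X):|f|^{-1}([1/n,\infty))\text{ has }\mathfrak{P}\text{ for each positive integer }n\},$$ and in particular, $$C^{\mathfrak P}_0(X)=\{f\in C_B(X):\mathrm{coz}(f)\text{ has }\mathfrak{P}\},$$ if $\mathfrak{P}$ is also preserved under countable closed sums. Furthermore: (1) $C^{\mathfrak P}_0(X)$ is a closed ideal in $C_B(X)$ which contains $C^{\mathfrak P}_{00}(X)$. (2) Let $X$ be completely regular. Then $C^{\mathfrak P}_0(X)$ is non-vanishing if and only if $X$ is locally-$\mathfrak{P}$. (3) Let $X$ be completely regular and locally-$\mathfrak{P}$. Then $C^{\mathfrak P}_0(X)$ is unital if and only if $X$ has $\mathfrak{P}$. (4) Let $X$ be completely regular and locally-$\mathfrak{P}$. Then $C^{\mathfrak P}_0(X)$ is a closed ideal of $C_B(X)$ isometrically isomorphic (as a normed algebra) to $C_0(Y)$ for some unique (up to homeomorphism) locally compact space $Y$, namely, for $Y=\lambda_{\mathfrak P}X$. In particular, $\lambda_{\mathfrak P}X$ is the spectrum of $C^{\mathfrak P}_0(X)$. Furthermore, $X$ is contained in $Y$ as a dense subspace; $C^{\mathfrak P}_{00}(X)$ is dense in $C^{\mathfrak P}_0(X)$; and the following are equivalent: $C^{\mathfrak P}_0(X)$ is unital; $X$ has $\mathfrak{P}$; $Y$ is compact.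
   Context: Completely regular, compact and locally compact spaces are assumed to be Hausdorff. $C_B(X)$ is the normed algebra of continuous bounded $f:X\to\mathbb{C}$ with the supremum norm. For continuous $f:X\to\mathbb{C}$, $\mathrm{coz}(f)=X\setminus f^{-1}(0)$ and $\mathrm{supp}(f)=\mathrm{cl}_X\mathrm{coz}(f)$; $\mathrm{Coz}(X)$ is the set of all cozero-sets $\mathrm{coz}(f)$ of $X$. $C_0(Y)$ is the set of $f\in C_B(Y)$ such that $|f|^{-1}([1/n,\infty))$ is compact for each positive integer $n$. $\beta X$ is the Stone–Čech compactification of $X$. A neighborhood of $A\subseteq X$ in $X$ is a set $U\subseteq X$ with $A\subseteq\mathrm{int}_XU$. The spectrum is the Gelfand spectrum (of a commutative $C^*$-algebra). A topological property $\mathfrak{P}$ is a homeomorphism-invariant property of spaces, always assumed non-empty (some space has $\mathfrak{P}$). $\mathfrak{P}$ is closed hereditary if any closed subspace of a space having $\mathfrak{P}$ also has $\mathfrak{P}$; it is preserved under finite (respectively, countable) closed sums if any space which is a finite (respectively, countable) union of closed subspaces each having $\mathfrak{P}$ also has $\mathfrak{P}$. A space $X$ is locally-$\mathfrak{P}$ if each $x\in X$ has a neighborhood in $X$ with $\mathfrak{P}$. Let $\mathfrak{I}_{\mathfrak P}=\{A\subseteq X:\mathrm{cl}_XA\text{ has }\mathfrak{P}\}$, and call its elements null; when $\mathfrak{P}$ is closed hereditary and preserved under finite closed sums, this is an ideal of sets (closed under subsets and finite unions). Define $$C^{\mathfrak P}_{00}(X)=\{f\in C_B(X):\mathrm{supp}(f)\text{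 has a null neighborhood in }X\},$$ $$C^{\mathfrak P}_0(X)=\{f\in C_B(X):|f|^{-1}([1/n,\infty))\text{ is null for each positive integer }n\},$$ and, for $X$ completely regular, $$\lambda_{\mathfrak P}X=\bigcup\{\mathrm{int}_{\beta X}\mathrm{cl}_{\beta X}C:C\in\mathrm{Coz}(X)\text{ and }\mathrm{cl}_XC\text{ has a null neighborhood in }X\}\subseteq\beta X.$$ An ideal $H$ of $C_B(X)$ is non-vanishing if for every $x\in X$ there is $h\in H$ with $h(x)\neq0$; it is unital if, as an algebra, it has a multiplicative identity. *)

(* Defs.v *)
From HB Require Import structures.
From mathcomp Require Import all_boot all_order all_algebra.
From mathcomp Require Import complex.
From mathcomp Require Import all_classical all_reals all_analysis.

Set Implicit Arguments.
Unset Strict Implicit.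
Unset Printing Implicit Defensive.

Import Order.TTheory GRing.Theory Num.Theory.
Import numFieldNormedType.Exports.

Local Open Scope classical_set_scope.
Local Open Scope ring_scope.

(* A space is an arbitrary [topologicalType] (possibly empty, no separation
   axiom); a subset [A] of a space is viewed as a subspace through
   [set_type A], which carries the topology induced by the inclusion. *)

Definition homeomorphic (X Y : topologicalType) : Prop :=
  exists (f : X -> Y) (g : Y -> X),
    [/\ cancel f g, cancel g f, continuous f & continuous g].

Definition embedding (X Y : topologicalType) (i : X -> Y) : Prop :=
  injective i /\
  forall U : set X, open U <-> exists2 V : set Y, open V & U = i @^-1` V.

Definition completely_regular (X : topologicalType) : Prop :=
  completely_regular_space X /\ hausdorff_space X.

Definition compact_hausdorff (X : topologicalType) : Prop :=
  compact [set: X] /\ hausdorff_space X.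

Definition locally_compact_hausdorff (X : topologicalType) : Prop :=
  locally_compact [set: X] /\ hausdorff_space X.

Section TopologicalProperties.
Variable P : topologicalType -> Prop.

Definition topological_property : Prop :=
  (exists X : topologicalType, P X) /\
  (forall X Y : topologicalType, homeomorphic X Y -> P X -> P Y).

Definition closed_hereditary : Prop :=
  forall (X : topologicalType) (A : set X), P X -> closed A -> P (set_type A).

Definition finite_closed_sums : Prop :=
  forall (X : topologicalType) (D : set (set X)),
    finite_set D -> (forall A, D A -> closed A /\ P (set_type A)) ->
    \bigcup_(A in D) A = [set: X] -> P X.

Definition countable_closed_sums : Prop :=
  forall (X : topologicalType) (D : set (set X)),
    countable D -> (forall A, D A -> closed A /\ P (set_type A)) ->
    \bigcup_(A in D) A = [set: X] -> P X.

(* The neighborhood [U] need be neither open nor closed. *)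
Definition is_locally (X : topologicalType) : Prop :=
  forall x : X, exists2 U : set X, nbhs x U & P (set_type U).

Definition null (X : topologicalType) (A : set X) : Prop :=
  P (set_type (closure A)).

Definition has_null_nbhd (X : topologicalType) (A : set X) : Prop :=
  exists2 U : set X, A `<=` interior U & null U.

End TopologicalProperties.

Section Functions.
Variables (R : realType) (X : topologicalType).
(* The ring operations and the scaling [a *: f] on [X -> R[i]^o] are the
   pointwise ones. *)
Implicit Types (f g h : X -> R[i]^o) (A H : set (X -> R[i]^o)).

Definition coz f : set X := [set x | f x != 0].
Definition supp f : set X := closure (coz f).

(* The preimage of [1/n, oo) under |f|, for n > 0. *)
Definition level f (n : nat) : set X :=
  [set x | n%:R^-1 <= Normc.normc (f x)].

Definition Coz : set (set X) :=
  [set coz f | f in [set f : X -> R[i]^o | continuous f]].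

Definition CB : set (X -> R[i]^o) :=
  [set f : X -> R[i]^o | continuous f /\
    exists M : R, forall x, Normc.normc (f x) <= M].

(* [sup set0 = 0], so this is also correct on the empty space. *)
Definition supnorm f : R := sup [set Normc.normc (f x) | x in [set: X]].

Definition C0 : set (X -> R[i]^o) :=
  [set f | CB f /\ forall n, (0 < n)%N -> compact (level f n)].

Definition C0P (P : topologicalType -> Prop) : set (X -> R[i]^o) :=
  [set f | CB f /\ forall n, (0 < n)%N -> null P (level f n)].

Definition C00P (P : topologicalType -> Prop) : set (X -> R[i]^o) :=
  [set f | CB f /\ has_null_nbhd P (supp f)].

(* Closure in [CB] for the supremum norm. *)
Definition CB_closure A : set (X -> R[i]^o) :=
  [set f | CB f /\
    forall e : R, 0 < e -> exists2 g, A g & supnorm (f - g) < e].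

Definition CB_ideal H : Prop :=
  [/\ H `<=` CB, H 0, forall f g, H f -> H g -> H (f + g) &
      forall f h, CB f -> H h -> H (f * h)].

Definition CB_closed_ideal H : Prop := CB_ideal H /\ CB_closure H `<=` H.

Definition non_vanishing H : Prop :=
  forall x : X, exists2 h, H h & h x != 0.

Definition unital H : Prop :=
  exists2 u, H u & forall f, H f -> u * f = f /\ f * u = f.

(* Nonzero multiplicative linear functionals on the algebra [H]. [set_type H]
   carries no ring structure, hence the equations between values; boundedness
   is automatic on a C*-algebra. *)
Definition characters H : set (prod_topology (fun _ : set_type H => R[i]^o)) :=
  [set phi |
    [/\ forall f g h : set_type H, val h = val f + val g ->
          phi h = phi f + phi g,
        forall (a : R[i]) (f h : set_type H), val h = a *: val f ->
          phi h = a * phi f,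
        forall f g h : set_type H, val h = val f * val g ->
          phi h = phi f * phi g &
        exists f : set_type H, phi f != 0]].

(* The Gelfand topology: pointwise convergence on [H]. *)
Definition spectrum H : topologicalType := set_type (@characters H).

End Functions.

Arguments characters {R X} H _.
Arguments CB R X : clear implicits.
Arguments C0 R X : clear implicits.
Arguments C0P R X P : clear implicits.
Arguments C00P R X P : clear implicits.
Arguments Coz R X : clear implicits.

Definition isometrically_isomorphic (R : realType) (X Y : topologicalType)
    (A : set (X -> R[i]^o)) (B : set (Y -> R[i]^o)) : Prop :=
  exists phi : (X -> R[i]^o) -> (Y -> R[i]^o),
    set_bij A B phi /\
    [/\ forall f g, A f -> A g -> phi (f + g) = phi f + phi g,
        forall (a : R[i]) f, A f -> phi (a *: f) = a *: phi f,
        forall f g, A f -> A g -> phi (f * g) = phi f * phi g &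
        forall f, A f -> supnorm (phi f) = supnorm f].

(* The Stone-Cech compactification: the closure of the image of [X] under the
   evaluation map into the cube indexed by all continuous [f : X -> [0, 1]]. *)
Section StoneCech.
Variables (R : realType) (X : topologicalType).

Definition unit_maps : set (X -> R) :=
  [set f : X -> R | continuous f /\ forall x, 0 <= f x <= 1].

Definition cube : topologicalType :=
  prod_topology (fun _ : set_type unit_maps => R).

Definition evaluation (x : X) : cube := fun f => val f x.

Definition stone_cech : topologicalType :=
  set_type (closure (range evaluation)).

Lemma evaluation_in_closure (x : X) :
  evaluation x \in closure (range evaluation).
Proof. by apply/mem_set/subset_closure; exists x. Qed.

Definition to_stone_cech (x : X) : stone_cech :=
  exist _ (evaluation x) (evaluation_in_closure x).

Definition lambdaP (P : topologicalType -> Prop) : set stone_cech :=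
  \bigcup_(C in [set C | Coz R X C /\ has_null_nbhd P (closure C)])
    interior (closure (to_stone_cech @` C)).

End StoneCech.
Arguments lambdaP R X P : clear implicits.

(* Main.v *)
(* Extending f in C0P to the Stone-Cech compactification and restricting to
   Y = lambda_P X identifies C0P with C0(Y).  Indeed the extension F of f
   vanishes off Y: if |F p| > d > 0, then the cozero set C = {|f| > d} has a null
   neighborhood of its closure, and cl C contains the neighborhood {|F| > d} of
   p.  Conversely a compact subset of Y is covered by finitely many of the open
   sets defining Y, so its trace on X is null.  A locally compact Hausdorff space
   Z is homeomorphic to the spectrum of C0(Z); hence Y is the spectrum of C0P,
   and Y is unique. *)
Require Import Defs.
From HB Require Import structures.
From mathcomp Require Import all_boot all_order all_algebra.
From mathcomp Require Import complex.
From mathcomp Require Import all_classical all_reals all_analysis.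
From mathcomp Require Import ring lra.

Set Implicit Arguments.
Unset Strict Implicit.
Unset Printing Implicit Defensive.

Import Order.TTheory GRing.Theory Num.Theory.
Import numFieldNormedType.Exports.

Local Open Scope classical_set_scope.
Local Open Scope ring_scope.
Import Normc.

(** A character is any nonzero multiplicative linear functional, with no continuity assumed, so it
    has to be recognized as a point evaluation by algebra alone. Since [C0] usually lacks a unit,
    neither 1 nor an inverse is ever an argument of the functional: division takes place in [CB],
    and multiplying by a member of the ideal leads back into [C0]. Restriction to [X] is composition
    with a map, so the isomorphism is built in that direction and then inverted; its surjectivity is
    the extension to the Stone-Cech compactification, where every map to [0, 1] is already a
    coordinate. As [P] is a predicate on types, passing to a subspace of a subspace always costs a
    homeomorphism. *)

Section ComplexFunctions.
Context {R : realType}.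

(** * Moduli, level sets and the supremum norm of complex functions *)

Lemma normc_norm (z : R[i]) : `|z| = (normc z)%:C%C.
Proof. by rewrite normc_def; case: z. Qed.

Lemma normc_ge0 (z : R[i]) : 0 <= normc z.
Proof. by rewrite -ler0c -normc_norm normr_ge0. Qed.

Lemma normc_real (a : R) : normc (a%:C%C : R[i]) = `|a|.
Proof. by rewrite /= expr0n/= addr0 sqrtr_sqr. Qed.

Lemma normcB (y z : R[i]) : normc (y - z) = normc (z - y).
Proof. by rewrite -(normcN (z - y)) opprB. Qed.

Lemma normc_leD (y z : R[i]) : normc (y + z) <= normc y + normc z.
Proof. exact: le_normcD. Qed.

Lemma normc_leB (y z : R[i]) : normc y <= normc z + normc (y - z).
Proof. by rewrite -[X in normc X <= _](subrK z) addrC normc_leD. Qed.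

Lemma normc_conj (z : R[i]) : normc z^*%C = normc z.
Proof. by case: z => a b /=; rewrite sqrrN. Qed.

Lemma mulcJ_normc (z : R[i]) : z^*%C * z = (normc z ^+ 2)%:C%C.
Proof. by rewrite mulrC -sqr_normc normc_norm rmorphXn. Qed.

Lemma normc_eq0 (z : R[i]) : (normc z == 0) = (z == 0).
Proof.
by apply/eqP/eqP => [/eq0_normc //|->]; exact: normc0.
Qed.

Lemma normc_gt0 (z : R[i]) : (0 < normc z) = (z != 0).
Proof. by rewrite lt_def normc_eq0 normc_ge0 andbT. Qed.

Context {X : topologicalType}.
Implicit Types (f g : X -> R[i]^o) (u : X -> R).

Lemma continuous_normcP f :
  continuous f <->
  forall x (e : R), 0 < e -> \forall y \near x, normc (f x - f y) < e.
Proof.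
split=> [cf x e e0|h x].
  have /cvgrPdist_lt/(_ e%:C%C) := cf x.
  rewrite ltcR => /(_ e0); apply: filterS => y.
  by rewrite normc_norm ltcR.
apply/cvgrPdist_lt => e e0.
have /complex_realP[r er] : e \is Num.real by exact: gtr0_real.
move: e0; rewrite er ltcR => r0.
by apply: filterS (h x r r0) => y; rewrite normc_norm ltcR.
Qed.

Lemma continuous_distP u :
  continuous u <->
  forall x (e : R), 0 < e -> \forall y \near x, `|u x - u y| < e.
Proof.
split=> [cu x e e0|h x]; first by have /cvgrPdist_lt/(_ _ e0) := cu x.
by apply/cvgrPdist_lt => e e0; exact: h.
Qed.

Lemma continuous_normc f : continuous f -> continuous (fun x => normc (f x)).
Proof.
move=> /continuous_normcP cf; apply/continuous_distP => x e /(cf x).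
apply: filterS => y; apply: le_lt_trans.
have := normc_leB (f x) (f y); have := normc_leB (f y) (f x).
rewrite (normcB (f y) (f x)) => h1 h2.
by rewrite ler_norml; apply/andP; split; lra.
Qed.

Lemma continuous_cplx u : continuous u ->
  continuous (fun x => (u x)%:C%C : R[i]^o).
Proof.
move=> /continuous_distP cu; apply/continuous_normcP => x e /(cu x).
by apply: filterS => y; rewrite -rmorphB normc_real.
Qed.

Lemma continuous_conj f : continuous f ->
  continuous (fun x => (f x)^*%C : R[i]^o).
Proof.
move=> /continuous_normcP cf; apply/continuous_normcP => x e /(cf x).
by apply: filterS => y; rewrite -rmorphB normc_conj.
Qed.

Lemma normc_Re (z : R[i]) : `|complex.Re z| <= normc z.
Proof.
by rewrite -lecR -normc_norm; have := normc_ge_Re z.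
Qed.

Lemma normc_Im (z : R[i]) : `|complex.Im z| <= normc z.
Proof.
by case: z => a b /=; rewrite -sqrtr_sqr ler_wsqrtr// lerDr sqr_ge0.
Qed.

Lemma continuous_Re f : continuous f -> continuous (fun x => complex.Re (f x)).
Proof.
move=> /continuous_normcP cf; apply/continuous_distP => x e /(cf x).
apply: filterS => y; apply: le_lt_trans.
by rewrite -raddfB; exact: normc_Re.
Qed.

Lemma continuous_Im f : continuous f -> continuous (fun x => complex.Im (f x)).
Proof.
move=> /continuous_normcP cf; apply/continuous_distP => x e /(cf x).
apply: filterS => y; apply: le_lt_trans.
by rewrite -raddfB; exact: normc_Im.
Qed.

Lemma continuousDc f g : continuous f -> continuous g ->
  continuous (f + g : X -> R[i]^o).
Proof.
move=> cf cg x; apply: (@continuousD _ _ _ f g x); [exact: cf|exact: cg].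
Qed.

Lemma continuousMc f g : continuous f -> continuous g ->
  continuous (f * g : X -> R[i]^o).
Proof.
move=> cf cg x; apply: (@continuousM R[i] X f g x); [exact: cf|exact: cg].
Qed.

Lemma closed_geR u (a : R) : continuous u -> closed [set x | a <= u x].
Proof.
move=> /continuous_closedP cu.
by apply: (cu [set y | a <= y]); apply: closed_ge.
Qed.

Lemma open_gtR u (a : R) : continuous u -> open [set x | a < u x].
Proof.
move=> /continuousP cu.
by apply: (cu [set y | a < y]); apply: open_gt.
Qed.

Lemma closed_level f n : continuous f -> closed (level f n).
Proof. by move=> /continuous_normc cf; apply: closed_geR. Qed.

Lemma levelP f x : f x != 0 -> exists2 n, (0 < n)%N & level f n x.
Proof.
rewrite -normc_gt0 => /ltr_add_invr[k]; rewrite add0r => /ltW h.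
by exists k.+1.
Qed.

Lemma level_coz f n : (0 < n)%N -> level f n `<=` coz f.
Proof.
move=> n0 x; rewrite /level /coz /= -normc_gt0; apply: lt_le_trans.
by rewrite invr_gt0 ltr0n.
Qed.

(** From 1/n <= |f| |g| <= M |g| follows 1 <= n M |g| <= m |g|, so one level of [g] controls a level
    of the product. *)
Lemma levelM f g n m (M : R) : (forall x, normc (f x) <= M) ->
  (0 < n)%N -> n%:R * M <= m%:R -> level (f * g) n `<=` level g m.
Proof.
move=> hM n0 nm x; rewrite /level /= normcM => h.
have n0' : (0 : R) < n%:R by rewrite ltr0n.
have fM := hM x; have g0 := normc_ge0 (g x).
have h1 : 1 <= n%:R * (normc (f x) * normc (g x)).
  by rewrite -ler_pdivrMl// mulr1.
have h2 : 1 <= m%:R * normc (g x).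
  apply: (le_trans h1); rewrite mulrA ler_wpM2r//.
  by apply: le_trans nm; rewrite ler_wpM2l// ltW.
(* [m = 0] would contradict [h2]. *)
have m0 : (0 : R) < m%:R by have := ler0n R m; nra.
by rewrite -[leLHS]mulr1 ler_pdivrMl.
Qed.

Lemma CBD f g : CB R X f -> CB R X g -> CB R X (f + g).
Proof.
move=> [cf [M hM]] [cg [N hN]]; split; first exact: continuousDc.
by exists (M + N) => x; rewrite (le_trans (normc_leD _ _))// lerD.
Qed.

Lemma CBM f g : CB R X f -> CB R X g -> CB R X (f * g).
Proof.
move=> [cf [M hM]] [cg [N hN]]; split; first exact: continuousMc.
by exists (M * N) => x; rewrite normcM ler_pM ?normc_ge0.
Qed.

Lemma CB_cst (a : R[i]^o) : CB R X (fun=> a).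
Proof. by split; [move=> x; exact: cvg_cst|exists (normc a)]. Qed.

Lemma CB_conj f : CB R X f -> CB R X (fun x => (f x)^*%C : R[i]^o).
Proof.
move=> [cf [M hM]]; split; first exact: continuous_conj.
by exists M => x; rewrite normc_conj.
Qed.

Lemma CB_cplx u : continuous u -> (forall x, 0 <= u x <= 1) ->
  CB R X (fun x => (u x)%:C%C).
Proof.
move=> cu u01; split; first exact: continuous_cplx.
by exists 1 => x; have /andP[u0 u1] := u01 x; rewrite normc_real ger0_norm.
Qed.

Lemma CBB f g : CB R X f -> CB R X g -> CB R X (f - g).
Proof.
move=> bf bg; have -> : f - g = f + (fun=> -1) * g.
  by apply/funext => x; rewrite !fctE mulN1r.
by apply: CBD => //; apply: CBM => //; exact: CB_cst.
Qed.

(** The bound [0 <= M] matters on the empty space, where [supnorm] is 0. *)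
Lemma supnorm_le f (M : R) : 0 <= M -> (forall x, normc (f x) <= M) ->
  supnorm f <= M.
Proof.
move=> M0 hM; rewrite /supnorm.
have [->|/set0P ne] := eqVneq [set normc (f x) | x in [set: X]] set0.
  by rewrite sup0.
by apply: ge_sup => // _ [x _ <-].
Qed.

Lemma le_supnorm f x : CB R X f -> normc (f x) <= supnorm f.
Proof.
move=> [_ [M hM]]; apply: sup_upper_bound; last by exists x.
by split; [exists (normc (f x)), x|exists M => _ [y _ <-]].
Qed.

Lemma supnorm_ge0 f : 0 <= supnorm f.
Proof.
rewrite /supnorm; set S := (X in sup X).
(* An unbounded [f] and the empty space both fall under the default value 0 of [sup]. *)
have [hs|nhs] := pselect (has_sup S); last by rewrite sup_out.
have [_ [x _ _]] := hs.1; apply: (le_trans (normc_ge0 (f x))).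
by apply: sup_upper_bound => //; exists x.
Qed.

End ComplexFunctions.

(** * Compactness, subspaces and homeomorphisms *)

Section Topology.
Implicit Types (S T U : topologicalType).

(** Replaces the choice of a finite subcover. The sets whose complement in [K] satisfies [Q] form a
    filter; if [Q K] failed it would be proper and cluster at a point of [K], yet it contains the
    complement of a good neighborhood of that point. *)
Lemma compact_ind T (K : set T) (Q : set T -> Prop) : compact K ->
  Q set0 -> (forall A B, A `<=` B -> Q B -> Q A) ->
  (forall A B, Q A -> Q B -> Q (A `|` B)) ->
  (forall x, K x -> exists2 V, nbhs x V & Q V) -> Q K.
Proof.
move=> cK Q0 Qsub QU Qloc; apply: contrapT => nQK.
pose F : set_system T := [set A | Q (K `\` A)].
have FF : Filter F.
  split.
  - by rewrite /F /= setDT.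
  - by move=> A B /= QA QB; rewrite /F /= setDIr; exact: QU.
  - by move=> A B AB; apply: Qsub => x [Kx nBx]; split=> // /AB.
have PF : ProperFilter F.
  by split=> //; rewrite /F /= setD0.
have [x [Kx clx]] : K `&` cluster F !=set0.
  by apply: cK; rewrite /F /= setDv.
have [V xV QV] := Qloc x Kx.
have FV : F (~` V) by apply: Qsub QV => y [_] /contrapT.
by have [y []] := clx _ _ FV xV.
Qed.

Lemma continuousC S T U (f : S -> T) (g : T -> U) :
  continuous f -> continuous g -> continuous (fun x => g (f x)).
Proof. by move=> cf cg x; apply: continuous_comp; [exact: cf|exact: cg]. Qed.

Definition to_set_type (T : Type) (A : set T) (x : T) (Ax : A x) : set_type A :=
  exist _ x (mem_set Ax).

Lemma open_set_typeP T (A : set T) (U : set (set_type A)) :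
  open U <-> exists2 V : set T, open V & U = val @^-1` V.
Proof. by split=> -[V oV UV]; exists V. Qed.

Lemma continuous_val T (A : set T) : continuous (val : set_type A -> T).
Proof. exact: initial_continuous. Qed.

Lemma continuous_set_type S T (A : set T) (f : S -> set_type A) :
  continuous (fun x => val (f x)) -> continuous f.
Proof.
move=> /continuousP cf; apply/continuousP => _ /open_set_typeP[V oV ->].
exact: cf.
Qed.

Lemma continuous_prod S (I : Type) (T : I -> topologicalType)
    (f : S -> prod_topology T) :
  (forall i, continuous (fun x => f x i)) -> continuous f.
Proof.
move=> cf x; apply/cvg_sup => i U [_ [[V oV <-]] Vx VU].
apply: (filterS VU); apply: (cf i x); exact: open_nbhs_nbhs.
Qed.

Lemma continuous_proj (I : Type) (T : I -> topologicalType) (i : I) :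
  continuous (fun f : prod_topology T => f i).
Proof.
move=> f; have /cvg_sup/(_ i) h : f --> f by apply: cvg_id.
move=> U fU; apply: h.
exact: (@initial_continuous _ _ (fun f : prod_topology T => f i)).
Qed.

Lemma set_type_hausdorff T (A : set T) :
  hausdorff_space T -> hausdorff_space (set_type A).
Proof.
move=> hT x y xy; apply: val_inj; apply: hT => B C xB yC.
have [z [Bz Cz]] := xy _ _ (continuous_val xB) (continuous_val yC).
by exists (val z).
Qed.

Lemma closed_set_type T (A B : set T) :
  closed B -> closed (val @^-1` B : set (set_type A)).
Proof. by move: (@continuous_val T A) => /continuous_closedP; apply. Qed.

(** The filter is pushed forward to [T]; the cluster point found there lies in [K], hence comes from
    the subspace. *)
Lemma compact_set_type T (A K : set T) : compact K -> K `<=` A ->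
  compact (val @^-1` K : set (set_type A)).
Proof.
move=> cK KA F PF FK.
have [x [Kx clx]] : K `&` cluster (val @ F) !=set0.
  by apply: cK; apply: filterS FK.
exists (exist _ x (mem_set (KA x Kx))); split=> // B C FB [_ [[V oV <-]] Vx VC].
have FB' : F (val @^-1` (val @` B)) by apply: filterS FB; exact: preimage_image.
have [_ [[z Bz <-] Vz]] := clx _ _ FB' (open_nbhs_nbhs (conj oV Vx)).
by exists z; split=> //; apply: VC.
Qed.

Lemma closure_sub_closed T (A B : set T) :
  closed B -> A `<=` B -> closure A `<=` B.
Proof. by move=> cB AB; rewrite [B](closure_id _).1//; exact: closureS. Qed.

Lemma open_set_type_locally_compact T (L : set T) :
  compact [set: T] -> hausdorff_space T -> open L ->
  locally_compact_hausdorff (set_type L).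
Proof.
move=> cT hT oL; split; last exact: set_type_hausdorff.
move=> x _.
have xL : nbhs (val x) L by apply: open_nbhs_nbhs; split=> //; exact: set_valP.
have [V xV VL] := compact_regular hT cT filterT xL.
exists (val @^-1` closure V).
  have h : nbhs x (val @^-1` V) by exact: continuous_val.
  by apply: filterS h => z Vz _; exact: subset_closure.
have cV : closed (closure V) by exact: closed_closure.
split; last exact: closed_set_type.
by apply: compact_set_type => //; apply: subclosed_compact cV cT _.
Qed.

Lemma homeomorphic_sym S T : homeomorphic S T -> homeomorphic T S.
Proof. by move=> [f [g [fg gf cf cg]]]; exists g, f. Qed.

Lemma homeomorphic_trans S T U :
  homeomorphic S T -> homeomorphic T U -> homeomorphic S U.
Proof.
move=> [f [g [fg gf cf cg]]] [h [k [hk kh ch ck]]].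
exists (h \o f), (g \o k); split.
- exact: can_comp.
- exact: can_comp.
- by move=> x; apply: continuous_comp; [exact: cf|exact: ch].
- by move=> x; apply: continuous_comp; [exact: ck|exact: cg].
Qed.

(** The same set, seen as a subspace of [B] or of [T], gives two different types; this is how [P]
    moves from one to the other. *)
Lemma homeomorphic_sub T (A B : set T) : A `<=` B ->
  homeomorphic (set_type (val @^-1` A : set (set_type B))) (set_type A).
Proof.
move=> AB.
have hf (x : set_type (val @^-1` A : set (set_type B))) : val (val x) \in A.
  by have /set_mem := valP x; rewrite inE.
have hg (x : set_type A) : val x \in B by apply/mem_set/AB/set_mem/(valP x).
have hg' (x : set_type A) : (exist _ (val x) (hg x) : set_type B) \in
    (val @^-1` A : set (set_type B)).
  by apply/mem_set => /=; exact/set_mem/(valP x).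
exists (fun x => exist _ (val (val x)) (hf x)),
  (fun x => exist _ (exist _ (val x) (hg x)) (hg' x)); split.
- by move=> x; apply/val_inj/val_inj.
- by move=> x; apply/val_inj.
- apply: continuous_set_type.
  exact: continuousC (@continuous_val _ _) (@continuous_val _ _).
- by do 2!apply: continuous_set_type; exact: continuous_val.
Qed.

Lemma homeomorphic_setT T : homeomorphic (set_type [set: T]) T.
Proof.
have h (x : T) : x \in [set: T] by rewrite inE.
exists val, (fun x => exist _ x (h x)); split.
- by move=> x; exact/val_inj.
- by [].
- exact: continuous_val.
- by apply: continuous_set_type => x; exact: cvg_id.
Qed.

Lemma homeomorphic_empty S T : (S -> False) -> (T -> False) -> homeomorphic S T.
Proof.
move=> S0 T0.
exists (fun x => False_rect _ (S0 x)), (fun x => False_rect _ (T0 x)).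
by split=> x; [case: (S0 x)|case: (T0 x)|case: (S0 x)|case: (T0 x)].
Qed.

End Topology.

(** * The ideal of null sets *)

Section NullSets.
Variable P : topologicalType -> Prop.
Hypotheses (P_top : topological_property P) (P_closed : closed_hereditary P).
Hypothesis P_fin : finite_closed_sums P.
Context {X : topologicalType}.
Implicit Types A B : set X.

Lemma prop_homeo (S T : topologicalType) : homeomorphic S T -> P S -> P T.
Proof. exact: P_top.2. Qed.

Lemma prop_closed_sub A B : closed A -> A `<=` B ->
  P (set_type B) -> P (set_type A).
Proof.
move=> cA AB PB; apply: prop_homeo (homeomorphic_sub AB) _.
by apply: P_closed => //; exact: closed_set_type.
Qed.

Lemma null_sub A B : A `<=` B -> null P B -> null P A.
Proof.
by move=> AB; apply: prop_closed_sub; [exact: closed_closure|exact: closureS].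
Qed.

Lemma null_closed A : closed A -> null P A = P (set_type A).
Proof. by move=> /closure_id {2}->. Qed.

(** Some space has [P]; its empty subset is closed, and all empty spaces are homeomorphic. *)
Lemma null0 : null P (set0 : set X).
Proof.
have [[Z PZ] _] := P_top.
rewrite null_closed; last exact: closed0.
apply: prop_homeo (P_closed PZ closed0).
by apply: homeomorphic_empty => -[x /set_mem].
Qed.

Lemma closed_trace A B : closed A -> A `<=` B -> P (set_type A) ->
  closed (val @^-1` A : set (set_type B)) /\
  P (set_type (val @^-1` A : set (set_type B))).
Proof.
move=> cA AB PA; split; first exact: closed_set_type.
exact: prop_homeo (homeomorphic_sym (homeomorphic_sub AB)) PA.
Qed.

(** The union of the two closures is taken as a space of its own, so that [P_fin] applies to their
    traces on it. *)
Lemma nullU A B : null P A -> null P B -> null P (A `|` B).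
Proof.
rewrite /null closureU => PA PB; set C := _ `|` _.
pose r E : set (set_type C) := val @^-1` E.
apply: (P_fin (D := [set r (closure A); r (closure B)])).
- exact: finite_set2.
- move=> _ [->|->]; apply: closed_trace => //; try exact: closed_closure.
  + exact: subsetUl.
  + exact: subsetUr.
- apply/seteqP; split=> // -[x xC] _; have [xA|xB] := set_mem xC.
  + by exists (r (closure A)) => //; left.
  + by exists (r (closure B)) => //; right.
Qed.

End NullSets.

(** * Ideals defined by level sets, and bump functions *)

Section LevelIdeals.
Context {R : realType} {X : topologicalType}.
Implicit Types (f g : X -> R[i]^o).

(** Serves [C0] with [Q] compactness and [C0P] with [Q] nullity. Passing to smaller sets is asked
    only for closed ones, as compactness demands; levels are closed. *)
Lemma CB_ideal_of_levels (Q : set X -> Prop) : Q set0 ->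
  (forall A B, closed A -> A `<=` B -> Q B -> Q A) ->
  (forall A B, Q A -> Q B -> Q (A `|` B)) ->
  CB_closed_ideal
    [set f | CB R X f /\ forall n, (0 < n)%N -> Q (level f n)].
Proof.
move=> Q0 Qsub QU.
have half (n : nat) : (n * 2)%:R^-1 = n%:R^-1 / 2 :> R by rewrite natrM invfM.
split; first split.
- by move=> f [].
- split=> [|n n0]; first exact: CB_cst.
  rewrite (_ : level 0 n = set0)//; apply/seteqP; split=> // x.
  by rewrite /level /= expr0n/= addr0 sqrtr0 leNgt invr_gt0 ltr0n n0.
- move=> f g [Bf Qf] [Bg Qg]; split=> [|n n0]; first exact: CBD.
  (* If |f + g| >= 1/n, one of the two moduli is at least 1/(2n). *)
  apply: (Qsub _ (level f (n * 2) `|` level g (n * 2))).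
  + by apply: closed_level; exact: (CBD Bf Bg).1.
  + move=> x; rewrite /level /= half => h.
    have := normc_leD (f x) (g x).
    have [|h1 h2] := leP (n%:R^-1 / 2) (normc (f x)); [by left|right].
    by move: h; rewrite fctE => h; lra.
  + by apply: QU; [apply: Qf|apply: Qg]; rewrite muln_gt0 n0.
- move=> f g Bf [Bg Qg]; split=> [|n n0]; first exact: CBM.
  have [_ [M hM]] := Bf.
  pose m := (Num.trunc (n%:R * M)).+1.
  apply: (Qsub _ (level g m)); last exact: Qg.
  + by apply: closed_level; exact: (CBM Bf Bg).1.
  + by apply: levelM hM n0 _; apply/ltW/truncnS_gt.
- move=> f [Bf hf]; split=> // n n0.
  have e0 : 0 < n%:R^-1 / 2 :> R by rewrite divr_gt0// invr_gt0 ltr0n.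
  have [g [Bg Qg] fg] := hf _ e0.
  (* Where |f| >= 1/n, an approximation within 1/(2n) still has modulus at least 1/(2n). *)
  apply: (Qsub _ (level g (n * 2))).
  + exact: closed_level Bf.1.
  + move=> x; rewrite /level /= half => h.
    have := normc_leB (f x) (g x); have := le_supnorm x (CBB Bf Bg).
    by rewrite fctE; lra.
  + by apply: Qg; rewrite muln_gt0 n0.
Qed.

Lemma C0_ideal : CB_ideal (C0 R X).
Proof.
apply: (CB_ideal_of_levels (Q := compact) _ _ _).1.
- exact: compact0.
- by move=> A B cA AB cB; exact: subclosed_compact cA cB AB.
- exact: compactU.
Qed.

Lemma CB_idealZ (H : set (X -> R[i]^o)) (a : R[i]) f :
  CB_ideal H -> H f -> H (a *: f).
Proof. by move=> [_ _ _ HM] Hf; apply: HM (CB_cst a) Hf. Qed.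

Lemma cr_bump (x : X) (U : set X) : completely_regular X -> nbhs x U ->
  exists u : X -> R, [/\ continuous u, (forall y, 0 <= u y <= 1), u x = 1 &
    forall y, ~ U y -> u y = 0].
Proof.
move=> [crX _]; rewrite nbhsE => -[V [oV Vx] VU].
have /(uniform_separatorP (R := R))[u [cu u01 ux uV]] :
    uniform_separator [set x] (~` V).
  by apply: crX; [exact: open_closedC|exact].
(* The separator is 0 at [x] and 1 off [V], hence the reflection. *)
exists (fun y => 1 - u y); split.
- move=> y; apply: cvgB; [exact: cvg_cst|exact: cu].
- move=> y; have := u01 (u y); rewrite /= in_itv/= => /(_ _)/andP[|? ?].
    by exists y.
  by apply/andP; split; lra.
- by rewrite (ux (u x)) ?subr0//; exists x.
- by move=> y nUy; rewrite (uV (u y)) ?subrr//; exists y => // /VU.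
Qed.

End LevelIdeals.

(** * The algebra [C0P] on [X]: ideal, non-vanishing, unit *)

Section C0P.
Context {R : realType} {P : topologicalType -> Prop}.
Hypotheses (P_top : topological_property P) (P_closed : closed_hereditary P).
Hypothesis P_fin : finite_closed_sums P.
Context {X : topologicalType}.
Implicit Types (f g : X -> R[i]^o).

Lemma C0P_closed_ideal : CB_closed_ideal (C0P R X P).
Proof.
apply: CB_ideal_of_levels; first exact: null0.
- by move=> A B _; exact: null_sub.
- exact: nullU.
Qed.

Lemma C0PE :
  C0P R X P =
  [set f | CB R X f /\ forall n, (0 < n)%N -> P (set_type (level f n))].
Proof.
apply/seteqP; split=> f [Bf Pf]; split=> // n n0; have := Pf n n0;
  by rewrite null_closed//; exact: closed_level Bf.1.
Qed.

(** The cozero set is the union of countably many levels, all closed in [X]; conversely each level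
    is a closed subset of it. *)
Lemma C0P_cozE : countable_closed_sums P ->
  C0P R X P = [set f | CB R X f /\ P (set_type (coz f))].
Proof.
move=> P_count; rewrite C0PE; apply/seteqP; split=> f [Bf Pf]; split=> //.
  (* The shift avoids index 0, whose level is all of [X] because [0^-1 = 0]. *)
  pose r n : set (set_type (coz f)) := val @^-1` level f n.+1.
  apply: (P_count _ (range r)).
  - exact: card_image_le.
  - move=> _ [n _ <-]; apply: closed_trace => //.
    + exact: closed_level Bf.1.
    + exact: level_coz.
    + exact: Pf.
  - apply/seteqP; split=> // -[x xf] _.
    have [[//|n] _ nx] := levelP (set_mem xf).
    by exists (r n) => //; exists n.
move=> n n0; apply: prop_closed_sub Pf => //.
- exact: closed_level Bf.1.
- exact: level_coz.
Qed.

Lemma C00P_sub : C00P R X P `<=` C0P R X P.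
Proof.
move=> f [Bf [U fU PU]]; split=> // n n0; apply: null_sub PU => //.
by move=> x /(level_coz n0) /(@subset_closure _ (coz f)) /fU /interior_subset.
Qed.

Lemma C0P_non_vanishing : completely_regular X ->
  non_vanishing (C0P R X P) <-> is_locally P X.
Proof.
move=> crX; rewrite C0PE; split=> [nv x|locP x].
  have [f [Bf Pf] /levelP[n n0 fx]] := nv x.
  (* [level f n] need not be a neighborhood of [x]; doubling [n] leaves room for the open set |f| >
     1/(2n). *)
  exists (level f n.*2); last by apply: Pf; rewrite double_gt0.
  apply: (@filterS _ _ _ [set y | n.*2%:R^-1 < normc (f y)]) => [y /ltW //|].
  apply: open_nbhs_nbhs; split.
    by apply: open_gtR; apply: continuous_normc; exact: Bf.1.
  apply: lt_le_trans fx; rewrite ltf_pV2 ?posrE ?ltr0n ?double_gt0//.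
  by rewrite ltr_nat -addnn -[X in (X < _)%N]addn0 ltn_add2l.
have [U xU PU] := locP x; have [u [cu u01 ux uU]] := cr_bump (R := R) crX xU.
have Bu := CB_cplx cu u01.
exists (fun y => (u y)%:C%C); last by rewrite ux oner_neq0.
(* The levels of the bump are closed in [X] and lie in [U], so they inherit [P] even if [U] is not
   closed. *)
split=> // n n0; apply: prop_closed_sub PU => //.
  exact: closed_level Bu.1.
move=> y; rewrite /level /mkset normc_real; apply: contraPP => /uU ->.
by rewrite normr0; apply/negP; rewrite -ltNge invr_gt0 ltr0n.
Qed.

Lemma C0P_one : P X -> C0P R X P (fun=> 1).
Proof.
move=> PX; rewrite C0PE; split=> [|n n0]; first exact: CB_cst.
by apply: P_closed => //; apply: closed_level (CB_cst 1).1.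
Qed.

Lemma C0P_one_prop : C0P R X P (fun=> 1) -> P X.
Proof.
rewrite C0PE => -[_ /(_ 1%N isT)].
rewrite (_ : level _ _ = setT); last first.
  by apply/seteqP; split=> // x _; rewrite /level /mkset normc1 invr1.
by apply: prop_homeo => //; exact: homeomorphic_setT.
Qed.

Lemma C0P_unital : completely_regular X -> is_locally P X ->
  unital (C0P R X P) <-> P X.
Proof.
move=> crX locP; split=> [[u Hu uf]|PX]; last first.
  exists (fun=> 1); first exact: C0P_one.
  by move=> f _; split; apply/funext => x; rewrite !fctE ?mul1r ?mulr1.
(* A unit equals 1 wherever some member of the ideal does not vanish, that is, everywhere. *)
apply: C0P_one_prop; rewrite (_ : (fun=> 1) = u)//; apply/funext => x.
have [h Hh hx] := (C0P_non_vanishing crX).2 locP x.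
have [/(congr1 (fun k => k x)) + _] := uf h Hh.
by rewrite fctE -[RHS]mul1r => /(mulIf hx).
Qed.

End C0P.

(** * Inverting isomorphisms; invariance of the spectrum *)

Section Isomorphisms.
Context {R : realType}.

(** The body of [isometrically_isomorphic] with the map exposed, so that a given map can be
    inverted. *)
Definition isometric_iso (X Y : topologicalType)
    (A : set (X -> R[i]^o)) (B : set (Y -> R[i]^o))
    (phi : (X -> R[i]^o) -> (Y -> R[i]^o)) : Prop :=
  set_bij A B phi /\
  [/\ forall f g, A f -> A g -> phi (f + g) = phi f + phi g,
      forall (a : R[i]) f, A f -> phi (a *: f) = a *: phi f,
      forall f g, A f -> A g -> phi (f * g) = phi f * phi g &
      forall f, A f -> supnorm (phi f) = supnorm f].

(** The maps act on all functions but are bijective only between [A] and [B], so preimages are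
    chosen in [A]. As [A] is stable under the operations, injectivity carries the identities over to
    the inverse. *)
Lemma isometric_iso_inverse (X Y : topologicalType)
    (A : set (X -> R[i]^o)) (B : set (Y -> R[i]^o)) phi :
  CB_ideal A -> isometric_iso A B phi ->
  exists2 theta, isometric_iso B A theta &
    (forall f, A f -> theta (phi f) = f) /\
    (forall g, B g -> phi (theta g) = g).
Proof.
move=> AI [[phiAB phi_inj phi_surj] [phiD phiZ phiM phi_norm]].
have [A_CB _ AD AM] := AI.
pose theta g := xget (0 : X -> R[i]^o) [set f | A f /\ phi f = g].
have thP g : B g -> A (theta g) /\ phi (theta g) = g.
  move=> /phi_surj[f Af fg].
  exact: (@xgetPex _ 0 [set f | A f /\ phi f = g] (ex_intro _ f (conj Af fg))).
have inj f f' : A f -> A f' -> phi f = phi f' -> f = f'.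
  by move=> Af Af'; apply: phi_inj; exact: mem_set.
have thK f : A f -> theta (phi f) = f.
  by move=> Af; have [? ?] := thP _ (phiAB _ Af); exact: inj.
exists theta; last by split=> // g /thP[].
split; split.
- by move=> g /thP[].
- move=> g g' /set_mem /thP[_ {2}<-] /set_mem /thP[_ {2}<-].
  by move=> ->.
- by move=> f Af; exists (phi f); [exact: phiAB|exact: thK].
- move=> f g /thP[Af {1}<-] /thP[Ag {1}<-].
  by rewrite -phiD// thK//; exact: AD.
- move=> a f /thP[Af {1}<-].
  by rewrite -phiZ// thK//; exact: CB_idealZ.
- move=> f g /thP[Af {1}<-] /thP[Ag {1}<-].
  by rewrite -phiM// thK//; apply: AM => //; exact: A_CB.
- by move=> f /thP[Af {2}<-]; rewrite phi_norm.
Qed.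

Section Pullback.
Context {X Y : topologicalType}.
Variables (A : set (X -> R[i]^o)) (B : set (Y -> R[i]^o)).
Variable phi : (X -> R[i]^o) -> (Y -> R[i]^o).
Hypothesis phi_iso : isometric_iso A B phi.

Lemma pull_subproof (F : set_type A) : phi (val F) \in B.
Proof.
by have [[phiAB _ _] _] := phi_iso; apply/mem_set/phiAB/set_mem/(valP F).
Qed.

Definition pull (F : set_type A) : set_type B :=
  exist _ (phi (val F)) (pull_subproof F).

Lemma pull_character (psi : set_type B -> R[i]^o) :
  characters B psi -> characters A (fun F => psi (pull F)).
Proof.
have [[phiAB phi_inj phi_surj] [phiD phiZ phiM phi_norm]] := phi_iso.
have val_A (F : set_type A) : A (val F) by exact/set_mem/(valP F).
move=> [psiD psiZ psiM [G psiG]]; split.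
- by move=> f g h hE; apply: psiD; rewrite /= hE phiD.
- by move=> a f h hE; apply: psiZ; rewrite /= hE phiZ.
- by move=> f g h hE; apply: psiM; rewrite /= hE phiM.
- have [f Af fG] := phi_surj _ (set_mem (valP G)).
  exists (to_set_type Af).
  by rewrite (_ : pull _ = G)//; exact: val_inj.
Qed.

Definition spectrum_pull (psi : spectrum B) : spectrum A :=
  to_set_type (pull_character (set_mem (valP psi))).

(** In the pointwise topology, the coordinate [F] of the image is the coordinate [pull F] of the
    argument. *)
Lemma spectrum_pull_continuous : continuous spectrum_pull.
Proof.
apply: continuous_set_type; apply: continuous_prod => F.
exact: (continuousC (@continuous_val _ _) (@continuous_proj _ _ (pull F))).
Qed.

End Pullback.

Lemma spectrum_iso (X Y : topologicalType)
    (A : set (X -> R[i]^o)) (B : set (Y -> R[i]^o)) :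
  CB_ideal A -> isometrically_isomorphic A B ->
  homeomorphic (spectrum A) (spectrum B).
Proof.
move=> AI [phi phi_iso].
have [theta theta_iso [thK phK]] := isometric_iso_inverse AI phi_iso.
exists (spectrum_pull theta_iso), (spectrum_pull phi_iso); split;
  try exact: spectrum_pull_continuous.
- move=> psi; apply: val_inj; apply: functional_extensionality_dep => F /=.
  congr (val psi _); apply: val_inj => /=; apply: thK.
  exact/set_mem/(valP F).
- move=> psi; apply: val_inj; apply: functional_extensionality_dep => F /=.
  congr (val psi _); apply: val_inj => /=; apply: phK.
  exact/set_mem/(valP F).
Qed.

End Isomorphisms.

(** * Characters of [C0] are point evaluations *)

Section SpectrumC0.
Context {R : realType} {Z : topologicalType}.
Hypothesis lchZ : locally_compact_hausdorff Z.
Implicit Types (f g : Z -> R[i]^o).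

(** The bump is cut off inside a compact neighborhood, which makes its levels compact. *)
Lemma lch_bump (z : Z) (U : set Z) : nbhs z U ->
  exists u : Z -> R, [/\ C0 R Z (fun y => (u y)%:C%C), u z = 1 &
    forall y, ~ U y -> u y = 0].
Proof.
move=> zU; have [lcZ hZ] := lchZ.
have [V] := lcZ z I; rewrite /within /= => zV [cV clV].
have zUV : nbhs z (U `&` V).
  by apply: filterI => //; apply: filterS zV => y; exact.
have crZ : completely_regular Z.
  by split=> //; exact: (locally_compact_completely_regular (R := R)).
have [u [cu u01 uz uUV]] := cr_bump (R := R) crZ zUV.
exists u; split=> // [|y nUy]; last by apply: uUV => -[].
have Bu := CB_cplx cu u01; split=> // n n0.
apply: (subclosed_compact _ cV); first exact: closed_level Bu.1.
move=> y; rewrite /level /mkset normc_real; apply: contraPP => nVy.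
rewrite uUV; last by case.
by rewrite normr0; apply/negP; rewrite -ltNge invr_gt0 ltr0n.
Qed.

Lemma CB_inv f (d : R) :
  0 < d -> continuous f -> (forall x, d <= normc (f x)) ->
  CB R Z (fun x => (f x)^-1).
Proof.
move=> d0 cf df; split.
  move=> x; apply: (@continuousV R[i] Z f x); last exact: cf.
  by rewrite -normc_gt0; exact: lt_le_trans (df x).
exists d^-1 => x; rewrite normcV lef_pV2// posrE//.
exact: lt_le_trans (df x).
Qed.

Lemma C0_conj f : C0 R Z f -> C0 R Z (fun x => (f x)^*%C).
Proof.
move=> [Bf cf]; split=> [|n n0]; first exact: CB_conj.
rewrite (_ : level _ n = level f n); first exact: cf.
by apply/seteqP; split=> x; rewrite /level /mkset normc_conj.
Qed.

(* If no point evaluation is [psi], the kernel of [psi] has no common zero; a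
   sum [u] of functions |f|^2 with f in the kernel is large on the compact set
   where |e| >= 1/2, and a = e / (1 + u) satisfies [psi a = 1] although 1 - a
   is invertible. *)
Lemma functional_eval (psi : (Z -> R[i]^o) -> R[i]) :
  (forall f g, C0 R Z f -> C0 R Z g -> psi (f + g) = psi f + psi g) ->
  (forall (a : R[i]) f, C0 R Z f -> psi (a *: f) = a * psi f) ->
  (forall f g, C0 R Z f -> C0 R Z g -> psi (f * g) = psi f * psi g) ->
  (exists2 f, C0 R Z f & psi f != 0) ->
  exists z, forall f, C0 R Z f -> psi f = f z.
Proof.
move=> psiD psiZ psiM [e' C0e' psie'].
have C0I := C0_ideal (R := R) (X := Z); have [C0B C00 C0D C0M] := C0I.
have C0MM f g : C0 R Z f -> C0 R Z g -> C0 R Z (f * g).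
  by move=> /C0B Bf Cg; exact: C0M.
have [e C0e psie] : exists2 e, C0 R Z e & psi e = 1.
  exists ((psi e')^-1 *: e'); first exact: CB_idealZ.
  by rewrite psiZ// mulVf.
(* At a common zero [z] of the kernel, [f - psi f *: e] vanishes, so [f z = psi f * e z]. A bump at
   [z] shows [e z != 0], and the case of [e * e] then gives [e z = 1]. *)
suff [z hz] : exists z, forall f, C0 R Z f -> psi f = 0 -> f z = 0.
  have fz f : C0 R Z f -> f z = psi f * e z.
    move=> C0f; have C0N : C0 R Z (- psi f *: e) by exact: CB_idealZ.
    have := hz (f + - psi f *: e) (C0D _ _ C0f C0N).
    rewrite psiD// psiZ// psie mulr1 subrr => /(_ erefl).
    rewrite !fctE => /eqP; rewrite addr_eq0 => /eqP ->.
    by rewrite /GRing.scale/= mulNr opprK.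
  have [ez|ez] := eqVneq (e z) 0.
    have [u [C0u uz _]] := lch_bump (filterT : nbhs z setT).
    have := fz _ C0u; rewrite uz ez mulr0 => /eqP.
    by rewrite oner_eq0.
  have /(mulIf ez) ez1 : 1 * e z = e z * e z.
    by have := fz _ (C0MM _ _ C0e C0e); rewrite psiM// psie mulr1 fctE => ->.
  by exists z => f /fz ->; rewrite -ez1 mulr1.
apply: contrapT => noz.
have [_ [M hM]] := C0B _ C0e.
(* The value 2M yields |e| / (1 + u) <= 1/2 everywhere: where |e| >= 1/2 the denominator exceeds 2M
   >= 2|e|, elsewhere it is at least 1. *)
pose Q (A : set Z) := exists u : Z -> R,
  [/\ C0 R Z (fun x => (u x)%:C%C), psi (fun x => (u x)%:C%C) = 0,
    forall x, 0 <= u x & forall x, A x -> 2 * M <= u x].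
have [u [C0u psiu u0 uM]] : Q (level e 2).
  apply: compact_ind.
  - exact: C0e.2.
  - have cplx0 : (fun=> 0%:C%C) = 0 :> (Z -> R[i]^o) by [].
    exists (fun=> 0); rewrite cplx0; split=> //.
    by have := psiZ 0 0 C00; rewrite mul0r scale0r.
  - by move=> A B AB [u [? ? ? uB]]; exists u; split=> // x /AB /uB.
  - move=> A B [u [C0u pu u0 uA]] [v [C0v pv v0 vB]].
    have uv : (fun x => (u x + v x)%:C%C) =
        (fun x => (u x)%:C%C) + (fun x => (v x)%:C%C) :> (Z -> R[i]^o).
      by apply/funext => x; rewrite fctE rmorphD.
    exists (fun x => u x + v x); split.
    + by rewrite uv; exact: C0D.
    + by rewrite uv psiD// pu pv addr0.
    + by move=> x; rewrite addr_ge0.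
    + by move=> x [/uA|/vB]; [have := v0 x|have := u0 x]; lra.
  - move=> z _; have [f [C0f psif fz]] :
        exists f, [/\ C0 R Z f, psi f = 0 & f z != 0].
      apply: contrapT => nof; apply: noz; exists z => f C0f psif.
      apply: contrapT => /eqP fz; apply: nof; by exists f.
    have nf : 0 < normc (f z) ^+ 2 by rewrite exprn_gt0// normc_gt0.
    have M0 : 0 <= M by exact: le_trans (normc_ge0 _) (hM z).
    (* Scales |f|^2 to the value 2M + 1 at [z], so that it exceeds 2M on a neighborhood. *)
    pose c := (2 * M + 1) / normc (f z) ^+ 2.
    have c0 : 0 <= c by rewrite divr_ge0 ?ltW//; lra.
    pose u x := c * normc (f x) ^+ 2.
    (* Written with the conjugate, |f|^2 is a multiple of [f] and hence stays in the kernel. *)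
    have uE : (fun x => (u x)%:C%C) =
        c%:C%C *: ((fun x => (f x)^*%C) * f) :> (Z -> R[i]^o).
      apply/funext => x; rewrite /u [LHS]rmorphM.
      by rewrite -[RHS]/(c%:C%C * ((f x)^*%C * f x)) mulcJ_normc.
    have C0h := C0MM _ _ (C0_conj C0f) C0f.
    have C0u : C0 R Z (fun x => (u x)%:C%C) by rewrite uE; exact: CB_idealZ.
    exists [set x | 2 * M < u x].
      apply: open_nbhs_nbhs; split.
        apply: open_gtR => x; have cf := continuous_normc (C0B _ C0f).1.
        apply: cvgM; first exact: cvg_cst.
        rewrite expr2; under eq_fun do rewrite expr2.
        by apply: cvgM; exact: cf.
      by rewrite /mkset /u /c mulfVK ?gt_eqF//; lra.
    exists u; split=> //.
    + rewrite uE psiZ// psiM//; last exact: C0_conj.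
      by rewrite psif !mulr0.
    + by move=> x; rewrite mulr_ge0// exprn_ge0// normc_ge0.
    + by move=> x /ltW.
pose g : Z -> R[i]^o := fun x => (u x)%:C%C.
pose w : Z -> R[i]^o := fun x => (((fun=> 1) + g) x)^-1.
have gE x : ((fun=> 1) + g) x = (1 + u x)%:C%C.
  by rewrite fctE /g rmorphD.
have gw x : (1 + g x) * w x = 1.
  rewrite /w gE /g -[X in X + _]/(1%:C%C) -rmorphD mulfV//.
  by rewrite -normc_gt0 normc_real normr_gt0 gt_eqF//; have := u0 x; lra.
have Bw : CB R Z w.
  apply: (@CB_inv _ 1) => //.
    by apply: continuousDc (C0B _ C0u).1; exact: (CB_cst 1).1.
  by move=> x; rewrite gE normc_real ger0_norm; have := u0 x; lra.
pose a := w * e.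
have C0a : C0 R Z a by exact: C0M.
(* Apply [psi] to e = a + u a, using that [psi] kills [u]. *)
have psia : psi a = 1.
  rewrite -psie -[LHS]addr0 -[X in _ + X](mul0r (psi a)) -psiu -psiM// -psiD//.
    congr psi; apply/funext => x.
    rewrite -[LHS]/(w x * e x + g x * (w x * e x)).
    by rewrite -[X in X + _]mul1r -mulrDl mulrA gw mul1r.
  exact: C0MM.
have a2 x : normc (a x) <= 2^-1.
  rewrite /a fctE normcM /w gE normcV normc_real.
  have ux := u0 x; have Mx := hM x; have e0 := normc_ge0 (e x).
  rewrite ger0_norm ?addr_ge0// mulrC ler_pdivrMr; last by lra.
  have [/uM|] := leP 2^-1 (normc (e x)); lra.
pose v : Z -> R[i]^o := fun x => (((fun=> 1) - a) x)^-1.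
have a1 x : 2^-1 <= normc (((fun=> 1) - a) x).
  have := normc_leB 1 (a x); rewrite normc1 fctE; have := a2 x.
  lra.
have Bv : CB R Z v.
  apply: (@CB_inv _ 2^-1) => //.
  exact: (CBB (CB_cst 1) (C0B _ C0a)).1.
(* b = a / (1 - a) lies in [C0] and satisfies b = a + a b; with [psi a = 1] this reads psi b = 1 +
   psi b. *)
pose b := v * a.
have C0b : C0 R Z b by exact: C0M.
have : psi b = psi a + psi a * psi b.
  rewrite -psiM// -psiD//; last exact: C0MM.
  congr psi; apply/funext => x.
  rewrite -[LHS]/(v x * a x) -[RHS]/(a x + a x * (v x * a x)).
  have vE : v x = 1 + v x * a x.
    apply/eqP; rewrite -subr_eq -[X in X - _]mulr1 -mulrBr; apply/eqP.
    by apply: mulVf; rewrite -normc_gt0; apply: lt_le_trans (a1 x).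
  by rewrite {1}vE mulrDl mul1r mulrC.
rewrite psia mul1r => /esym/eqP; rewrite -subr_eq0 addrK.
by rewrite oner_eq0.
Qed.

Lemma spectrum_C0 : homeomorphic Z (spectrum (C0 R Z)).
Proof.
have C0I := C0_ideal (R := R) (X := Z); have [C0B C00 C0D C0M] := C0I.
have val_C0 (F : set_type (C0 R Z)) : C0 R Z (val F) by exact/set_mem/(valP F).
pose ev (z : Z) : prod_topology (fun _ : set_type (C0 R Z) => R[i]^o) :=
  fun F => val F z.
have ev_char z : characters (C0 R Z) (ev z).
  split.
  - by move=> f g h; rewrite /ev => ->.
  - by move=> a f h; rewrite /ev => ->.
  - by move=> f g h; rewrite /ev => ->.
  - have [u [C0u uz _]] := lch_bump (filterT : nbhs z setT).
    exists (to_set_type C0u); rewrite /ev /= uz.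
    exact: oner_neq0.
have char_ev (phi : spectrum (C0 R Z)) : exists z, val phi = ev z.
  have [phiD phiZ phiM [F phiF]] := set_mem (valP phi).
  (* Extension by 0 turns a functional on the bare type [set_type (C0 R Z)] into one on all
     functions. *)
  pose psi f := if pselect (C0 R Z f) is left C0f
    then val phi (to_set_type C0f) else 0.
  have psiE (G : set_type (C0 R Z)) : psi (val G) = val phi G.
    rewrite /psi; case: pselect => [C0G|/(_ (val_C0 G))//].
    by congr (val phi _); exact: val_inj.
  pose S f (C0f : C0 R Z f) : set_type (C0 R Z) := to_set_type C0f.
  have psiS f (C0f : C0 R Z f) : psi f = val phi (S f C0f) by rewrite -psiE.
  have [|||| z hz] := @functional_eval psi.
  - move=> f g C0f C0g; rewrite !psiS; first exact: C0D.
    by move=> ?; apply: phiD.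
  - move=> c f C0f; rewrite !psiS; first exact: CB_idealZ.
    by move=> ?; apply: phiZ.
  - move=> f g C0f C0g; rewrite !psiS; first exact: C0M (C0B _ C0f) C0g.
    by move=> ?; apply: phiM.
  - by exists (val F) => //; rewrite psiE.
  exists z; apply: functional_extensionality_dep => G.
  by rewrite -psiE hz.
pose g phi := sval (cid (char_ev phi)).
have gP (phi : spectrum (C0 R Z)) (F : set_type (C0 R Z)) :
    val phi F = val F (g phi).
  by rewrite /g; case: cid => z /= ->.
pose f z : spectrum (C0 R Z) := to_set_type (ev_char z).
exists f, g; split.
(* Otherwise a bump is 1 at [z] and 0 at [g (f z)], although evaluation at both points is the same
   character. *)
- move=> z; apply: contrapT => zg.
  have [|u [C0u uz u0]] := @lch_bump z (~` [set g (f z)]).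
    apply: open_nbhs_nbhs; split; last by move=> zE; exact: zg.
    apply: closed_openC; apply: accessible_closed_set1.
    exact: hausdorff_accessible lchZ.2.
  have := gP (f z) (to_set_type C0u); rewrite /= /ev /= uz u0.
    by move=> /eqP; rewrite oner_eq0.
  exact.
- move=> phi; apply: val_inj; apply: functional_extensionality_dep => F.
  exact/esym/gP.
- apply: continuous_set_type; apply: continuous_prod => F.
  exact: (C0B _ (val_C0 F)).1.
(* For a bump [u] at [g phi] vanishing off [U], the characters that are nonzero on [u] form an open
   set which [g] maps into [U]. *)
- move=> phi U /lch_bump[u [C0u ug u0]].
  pose F : set_type (C0 R Z) := to_set_type C0u.
  have cF : continuous (fun psi : spectrum (C0 R Z) => val psi F : R[i]^o).
    exact: (continuousC (@continuous_val _ _) (@continuous_proj _ _ F)).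
  apply: (@filterS _ _ _ [set psi : spectrum (C0 R Z) | 0 < normc (val psi F)]).
    move=> psi; rewrite /mkset gP normc_gt0 => un; apply: contrapT => /u0 ug0.
    by case/negP: un; rewrite /= ug0.
  apply: open_nbhs_nbhs; split.
    by apply: open_gtR; exact: continuous_normc.
  by rewrite /mkset gP normc_gt0 /= ug; exact: oner_neq0.
Qed.

End SpectrumC0.

(** * Inequalities and equalities extended from a dense image *)

Section Density.
Context {R : realType} {X Y : topologicalType} (j : X -> Y).
Hypothesis j_dense : dense (range j).

Lemma dense_le (u : Y -> R) (M : R) : continuous u ->
  (forall x, u (j x) <= M) -> forall y, u y <= M.
Proof.
move=> cu uM y; rewrite leNgt; apply/negP => My.
have [|z [/= Mz [x _ xz]]] := j_dense _ (open_gtR M cu); first by exists y.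
by move: Mz; rewrite -xz ltNge uM.
Qed.

Lemma dense_eq (f g : Y -> R[i]^o) : CB R Y f -> CB R Y g ->
  (forall x, f (j x) = g (j x)) -> f = g.
Proof.
move=> Bf Bg fg; apply/funext => y; apply/eqP.
rewrite -subr_eq0 -normc_eq0 eq_le normc_ge0 andbT.
apply: (dense_le (u := fun y => normc ((f - g) y))) => [|x].
  by apply: continuous_normc; exact: (CBB Bf Bg).1.
by rewrite !fctE fg subrr normc0.
Qed.

End Density.

(** * The Stone-Cech compactification and extension of bounded functions *)

Section StoneCech.
Context {R : realType} {X : topologicalType}.
Local Notation bX := (stone_cech R X).
Local Notation i := (@to_stone_cech R X).

Lemma stone_cech_proj_continuous (u : set_type (@unit_maps R X)) :
  continuous (fun p : bX => val p u).
Proof. exact: (continuousC (@continuous_val _ _) (@continuous_proj _ _ u)). Qed.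

Lemma to_stone_cech_continuous : continuous i.
Proof.
apply: continuous_set_type; apply: continuous_prod => u.
exact: (set_mem (valP u)).1.
Qed.

Lemma cube_hausdorff : hausdorff_space (@cube R X).
Proof.
by apply: hausdorff_product => u; exact: (@norm_hausdorff R R).
Qed.

Lemma stone_cech_hausdorff : hausdorff_space bX.
Proof. apply: set_type_hausdorff; exact: cube_hausdorff. Qed.

Lemma stone_cech_compact : compact [set: bX].
Proof.
(* The factors of [cube] are all of [R]; compactness comes from the part with coordinates in
   [0, 1]. *)
pose K : set (@cube R X) := [set p | forall u, `[0, 1]%classic (p u)].
have cK : compact K.
  exact: (@tychonoff (set_type (@unit_maps R X)) (fun=> R)
    (fun=> `[0, 1]%classic) (fun=> @segment_compact R 0 1)).
have clK : closed K := compact_closed cube_hausdorff cK.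
rewrite (_ : setT = val @^-1` closure (range (@evaluation R X))).
  apply: compact_set_type => //; apply: subclosed_compact cK _.
    exact: closed_closure.
  apply: closure_sub_closed => // _ [x _ <-] u.
  by have /(_ x) := (set_mem (valP u)).2; rewrite /= in_itv.
by apply/seteqP; split=> // p _; exact/set_mem/(valP p).
Qed.

Lemma stone_cech_meets (W : set bX) (p : bX) : nbhs p W -> exists x, W (i x).
Proof.
move=> [_ [[V oV <-]] Vp VW].
have [_ [[x _ <-] Vx]] := set_mem (valP p) _ (open_nbhs_nbhs (conj oV Vp)).
by exists x; apply: VW.
Qed.

Lemma stone_cech_closure_preimage (W : set bX) : open W ->
  W `<=` closure (i @` (i @^-1` W)).
Proof.
move=> oW p Wp B pB.
have [x [Wx Bx]] : exists x, (W `&` B) (i x).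
  by apply: (@stone_cech_meets _ p); apply: filterI => //; exact: open_nbhs_nbhs.
by exists (i x); split=> //; exists x.
Qed.

(** A bump at [x] vanishing on [C] is a coordinate of the cube, and this coordinate keeps [i x] away
    from the closure of the image of [C]. *)
Lemma closure_to_stone_cech (C : set X) (x : X) : completely_regular X ->
  closure (i @` C) (i x) -> closure C x.
Proof.
move=> crX iCx; apply: contrapT => nCx.
have [|u [cu u01 ux uC]] := @cr_bump R X x (~` closure C) crX.
  by apply: open_nbhs_nbhs; split=> //; apply/closed_openC/closed_closure.
have unit_u : unit_maps u by [].
pose U := to_set_type unit_u.
have [|_ [[y Cy <-] /=]] := iCx [set p | 0 < val p U].
  apply: open_nbhs_nbhs; split; last by rewrite /mkset /= /evaluation /= ux.
  by apply: open_gtR; exact: stone_cech_proj_continuous.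
rewrite /evaluation /= uC ?ltxx//; apply; exact: subset_closure.
Qed.

Lemma to_stone_cech_inj : completely_regular X -> injective i.
Proof.
move=> crX x y xy; have cx : closed [set x].
  by apply: accessible_closed_set1; exact: hausdorff_accessible crX.2.
suff : closure [set x] y by rewrite -(closure_id _).1.
apply: closure_to_stone_cech => //.
by apply: subset_closure; exists x.
Qed.

(** An affine change of scale brings [u] into [0, 1]; there it is a coordinate, and undoing the
    change on that coordinate gives the extension. *)
Lemma stone_cech_extension_real (u : X -> R) (M : R) : continuous u ->
  (forall x, `|u x| <= M) ->
  exists2 U : bX -> R, continuous U & forall x, U (i x) = u x.
Proof.
(* [M] may be 0, or negative if [X] is empty; [N] has to be a positive divisor. *)
move=> cu uM; pose N := `|M| + 1.
have N0 : 0 < N by rewrite /N ltr_wpDl.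
pose v x := (u x / N + 1) / 2.
have unit_v : unit_maps v.
  split=> [x|x].
    apply: cvgM; last exact: cvg_cst.
    apply: cvgD; last exact: cvg_cst.
    by apply: cvgM; [exact: cu|exact: cvg_cst].
  have : `|u x / N| <= 1.
    rewrite normrM normfV (ger0_norm (ltW N0)) ler_pdivrMr// mul1r.
    by apply: le_trans (uM x) _; rewrite /N ler_wpDr// ler_norm.
  by rewrite /v ler_norml => /andP[? ?]; apply/andP; split; lra.
exists (fun p : bX => N * (2 * val p (to_set_type unit_v) - 1)).
  apply: (continuousC (@stone_cech_proj_continuous (to_set_type unit_v))
    (g := fun t : R => N * (2 * t - 1))) => t.
  apply: cvgM; first exact: cvg_cst.
  apply: cvgB; last exact: cvg_cst.
  by apply: cvgM; first exact: cvg_cst.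
by move=> x; rewrite /= /evaluation /= /v; field; rewrite gt_eqF.
Qed.

Lemma stone_cech_extension (f : X -> R[i]^o) : CB R X f ->
  exists2 F : bX -> R[i]^o, continuous F & forall x, F (i x) = f x.
Proof.
move=> [cf [M fM]].
have [|U cU Ui] := @stone_cech_extension_real _ M (continuous_Re cf).
  by move=> x; apply: le_trans (fM x); exact: normc_Re.
have [|V cV Vi] := @stone_cech_extension_real _ M (continuous_Im cf).
  by move=> x; apply: le_trans (fM x); exact: normc_Im.
exists ((fun p => (U p)%:C%C) + (fun=> 'i%C) * (fun p => (V p)%:C%C)).
  apply: continuousDc; first exact: continuous_cplx.
  apply: continuousMc; last exact: continuous_cplx.
  exact: (CB_cst 'i%C).1.
by move=> x; rewrite !fctE Ui Vi -complexE.
Qed.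

End StoneCech.

(** * The space [lambdaP] and the isomorphism with its [C0] *)

Section Lambda.
Context {R : realType} {P : topologicalType -> Prop}.
Hypotheses (P_top : topological_property P) (P_closed : closed_hereditary P).
Hypothesis P_fin : finite_closed_sums P.
Context {X : topologicalType}.
Hypotheses (crX : completely_regular X).
Implicit Types (f g : X -> R[i]^o).
Local Notation i := (@to_stone_cech R X).
Local Notation Y := (set_type (lambdaP R X P)).

(** With 1/(m+1) < d, the closure of [C] stays in the closed set |f| >= d, hence in the open set |f|
    > 1/(m+1), which lies in a null level. *)
Lemma has_null_nbhd_closure f (C : set X) (d : R) : C0P R X P f -> 0 < d ->
  (forall x, C x -> d <= normc (f x)) -> has_null_nbhd P (closure C).
Proof.
move=> [Bf Pf] /ltr_add_invr[m]; rewrite add0r => md Cd.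
have cf := continuous_normc Bf.1.
exists (level f m.+1); last exact: Pf.
apply: (@subset_trans _ [set x | m.+1%:R^-1 < normc (f x)]).
  apply: (@subset_trans _ [set x | d <= normc (f x)]).
    by apply: closure_sub_closed => //; exact: closed_geR.
  by move=> x; exact: lt_le_trans.
by rewrite -open_subsetE; [move=> x /ltW|exact: open_gtR].
Qed.

(* The positive part of |f x| - d. *)
Definition excess f (d : R) x : R :=
  ((normc (f x) - d) + `|normc (f x) - d|) / 2.

Lemma excess_continuous f d : continuous f -> continuous (excess f d).
Proof.
move=> cf; have cfd : continuous (fun x => normc (f x) - d).
  by move=> x; apply: cvgB; [exact: continuous_normc|exact: cvg_cst].
move=> x; apply: cvgM; last exact: cvg_cst.
apply: cvgD; first exact: cfd.
exact: (continuousC cfd (@norm_continuous R R)).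
Qed.

Lemma excess_eq0 f d x : normc (f x) <= d -> excess f d x = 0.
Proof.
by rewrite -subr_le0 /excess => /ler0_norm ->; rewrite subrr mul0r.
Qed.

Lemma excessE f d x : d <= normc (f x) -> excess f d x = normc (f x) - d.
Proof. by rewrite -subr_ge0 /excess => /ger0_norm ->; lra. Qed.

Lemma excess_ge0 f d x : 0 <= excess f d x.
Proof.
have [h|/ltW h] := leP d (normc (f x)); first by rewrite excessE// subr_ge0.
by rewrite excess_eq0.
Qed.

Lemma lambda_nonzero (F : stone_cech R X -> R[i]^o) p : continuous F ->
  C0P R X P (fun x => F (i x)) -> F p != 0 -> lambdaP R X P p.
Proof.
move=> cF C0F; rewrite -normc_gt0 => /ltr_add_invr[n]; rewrite add0r.
set d := _^-1 => dF; pose f x := F (i x).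
have d0 : 0 < d by rewrite invr_gt0.
have cf : continuous f := C0F.1.1.
pose C := [set x | d < normc (f x)].
exists C.
  split; last by apply: has_null_nbhd_closure C0F d0 _ => x; exact: ltW.
  (* [lambdaP] is indexed by cozero sets; the positive part of |f| - d exhibits [C] as one. *)
  exists (fun x => (excess f d x)%:C%C).
    by apply: continuous_cplx; exact: excess_continuous.
  apply/seteqP; split=> x; rewrite /coz /C /mkset -normc_gt0 normc_real.
    rewrite normr_gt0; apply: contraLR; rewrite -leNgt => /excess_eq0 ->.
    by rewrite eqxx.
  by move=> dx; rewrite excessE ?ltW// normr_gt0 gt_eqF// subr_gt0.
have oW : open [set q | d < normc (F q)] by apply/open_gtR/continuous_normc.
apply: (@filterS _ _ _ [set q | d < normc (F q)]); last exact: open_nbhs_nbhs.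
exact: stone_cech_closure_preimage oW.
Qed.

Lemma lambda_open : open (lambdaP R X P).
Proof. by apply: bigcup_open => C _; exact: open_interior. Qed.

Lemma lambda_locally_compact : locally_compact_hausdorff Y.
Proof.
apply: open_set_type_locally_compact lambda_open.
- exact: stone_cech_compact.
- exact: stone_cech_hausdorff.
Qed.

(** The approximant [f * w] is [f] with modulus lowered to the positive part of |f| - d. It vanishes
    where |f| <= d, which gives its support a null neighborhood; the form h / (h + d) of [w] avoids
    dividing by |f| at zeros of [f]. *)
Lemma C00P_dense : C0P R X P `<=` CB_closure (C00P R X P).
Proof.
move=> f C0f; have [Bf _] := C0f; split=> // e /ltr_add_invr[n].
rewrite add0r; set d := _^-1 => de; have d0 : 0 < d by rewrite invr_gt0.
pose h := excess f d; have h0 := excess_ge0 f d.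
have hd x : 0 < h x + d by rewrite ltr_wpDl// h0.
have ch : continuous h by apply: excess_continuous; exact: Bf.1.
pose w x := h x / (h x + d).
have Bw : CB R X (fun x => (w x)%:C%C).
  apply: CB_cplx => x.
    apply: cvgM; first exact: ch.
    apply: cvgV; first by rewrite gt_eqF.
    by apply: cvgD; [exact: ch|exact: cvg_cst].
  rewrite divr_ge0 ?h0//=; last exact/ltW.
  by rewrite ler_pdivrMr// mul1r lerDl ltW.
(* |f - f w| = min(|f|, d) *)
exists (f * (fun x => (w x)%:C%C)).
  split; first exact: CBM.
  apply: (has_null_nbhd_closure C0f d0) => x; rewrite /coz /mkset fctE.
  rewrite leNgt; apply: contraNN => /ltW /excess_eq0 hx.
  by rewrite /w /h hx mul0r mulr0.
apply: le_lt_trans de; apply: supnorm_le => [|x]; first exact: ltW.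
rewrite (_ : (_ - _) x = f x * (1 - w x)%:C%C); last first.
  by rewrite !fctE rmorphB mulrBr mulr1.
rewrite normcM normc_real.
have -> : 1 - w x = d / (h x + d).
  by rewrite /w; field; rewrite gt_eqF.
rewrite ger0_norm; last by rewrite divr_ge0// ltW.
rewrite mulrA ler_pdivrMr// mulrC (ler_wpM2l (ltW d0))//.
have [fd|/ltW fd] := leP (normc (f x)) d.
  by rewrite /h excess_eq0// add0r.
by rewrite /h excessE// subrK.
Qed.

Hypothesis locP : is_locally P X.

(** Being locally-[P] provides a member of [C0P] that is nonzero at [x], and so is its extension at
    the image of [x]. *)
Lemma lambda_to_stone_cech x : lambdaP R X P (i x).
Proof.
have [f C0f fx] := (C0P_non_vanishing (R := R) P_top P_closed crX).2 locP x.
have [F cF Fi] := stone_cech_extension C0f.1.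
apply: (lambda_nonzero cF); last by rewrite Fi.
by rewrite (_ : (fun x => F (i x)) = f)//; exact/funext.
Qed.

Definition to_lambda x : Y := to_set_type (lambda_to_stone_cech x).

Lemma to_lambda_continuous : continuous to_lambda.
Proof. by apply: continuous_set_type; exact: to_stone_cech_continuous. Qed.

Lemma to_lambda_dense : dense (range to_lambda).
Proof.
move=> O [y Oy] /open_set_typeP[V oV OV]; rewrite {}OV in Oy *.
have [x Vx] := stone_cech_meets (open_nbhs_nbhs (conj oV Oy)).
by exists (to_lambda x); split=> //; exists x.
Qed.

Lemma to_lambda_embedding : embedding to_lambda.
Proof.
split=> [x y /(congr1 val)|U]; first exact: to_stone_cech_inj.
split=> [oU|[V oV ->]]; last first.
  by move/continuousP : to_lambda_continuous; apply.
(* The closure of the image of the closed set [~]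
   U[meets the image of]X[only in the image of]~[U]. *)
exists (val @^-1` (~` closure (i @` (~` U)))).
  apply/open_set_typeP; exists (~` closure (i @` (~` U))) => //.
  by apply: closed_openC; exact: closed_closure.
apply/seteqP; split=> x Ux; last first.
  apply: contrapT => nUx; apply: Ux; apply: subset_closure.
  by exists x.
move=> /= /(closure_to_stone_cech crX).
by rewrite -(closure_id _).1; [exact|exact: open_closedC].
Qed.

Lemma C0_lambda_restrict (g : Y -> R[i]^o) : C0 R Y g ->
  C0P R X P (fun x => g (to_lambda x)).
Proof.
move=> [[cg [M gM]] Kg]; split=> [|n n0].
  split; last by exists M => x.
  exact: continuousC to_lambda_continuous cg.
apply: (compact_ind (Q := fun A => null P (to_lambda @^-1` A)) (Kg n n0)).
- exact: null0.
- by move=> A B AB; apply: null_sub => // x; exact: AB.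
- by move=> A B; exact: nullU.
- move=> y _; have [C [_ [U CU PU]] Cy] := set_mem (valP y).
  (* The trace on [X] of this neighborhood lies in the closure of [C], hence in the null set [U]. *)
  exists (val @^-1` interior (closure (i @` C))).
    apply: (@continuous_val _ (lambdaP R X P)).
    by apply: open_nbhs_nbhs; split=> //; exact: open_interior.
  apply: null_sub PU => // x /interior_subset /(closure_to_stone_cech crX).
  by move=> /CU /interior_subset.
Qed.

Lemma C0P_lambda_extend f : C0P R X P f ->
  exists2 g : Y -> R[i]^o, C0 R Y g & forall x, g (to_lambda x) = f x.
Proof.
move=> C0f; have [F cF Fi] := stone_cech_extension C0f.1.
have FiE : (fun x => F (i x)) = f by exact/funext.
have cg : continuous (fun y : Y => F (val y)).
  exact: continuousC (@continuous_val _ _) cF.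
exists (fun y : Y => F (val y)); last by move=> x; exact: Fi.
split=> [|n n0].
  split=> //; have [_ [M fM]] := C0f.1; exists M.
  apply: (dense_le to_lambda_dense); first exact: continuous_normc.
  by move=> x; rewrite /= Fi.
(* The level of [F] is closed in the compactification, hence compact, and it lies inside [lambdaP]
   because [F] vanishes elsewhere. *)
rewrite (_ : level _ n = (val : Y -> _) @^-1` level F n)//.
apply: compact_set_type.
  apply: (subclosed_compact _ stone_cech_compact) => //.
  exact: closed_level.
move=> p /(level_coz n0) Fp; apply: (lambda_nonzero cF) => //.
by rewrite FiE.
Qed.

Lemma C0P_lambda_iso : isometrically_isomorphic (C0P R X P) (C0 R Y).
Proof.
have C0B (g : Y -> R[i]^o) : C0 R Y g -> CB R Y g by case.
have C0PB f : C0P R X P f -> CB R X f by case.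
pose rho (g : Y -> R[i]^o) : X -> R[i]^o := fun x => g (to_lambda x).
have rho_iso : isometric_iso (C0 R Y) (C0P R X P) rho.
  split; split=> //.
  - exact: C0_lambda_restrict.
  - move=> g h /set_mem C0g /set_mem C0h gh.
    apply: (dense_eq to_lambda_dense); [exact: C0B|exact: C0B|].
    by move=> x; have := congr1 (fun k => k x) gh.
  - move=> f /C0P_lambda_extend[g C0g gf]; exists g => //; exact/funext.
  - move=> g C0g; apply/eqP; rewrite eq_le; apply/andP; split.
      apply: supnorm_le => [|x]; first exact: supnorm_ge0.
      exact: (le_supnorm (to_lambda x) (C0B _ C0g)).
    (* A bound valid on the dense image of [X] holds on all of [Y]. *)
    apply: supnorm_le; first exact: supnorm_ge0.
    apply: (dense_le to_lambda_dense).
      by apply: continuous_normc; exact: (C0B _ C0g).1.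
    move=> x; apply: (le_supnorm (f := rho g)).
    by apply: C0PB; exact: C0_lambda_restrict.
have [theta theta_iso _] := isometric_iso_inverse C0_ideal rho_iso.
by exists theta.
Qed.

(** Both sides say that the constant 1 belongs to the algebra: by density its extension to [Y] is
    again 1, whose first level is all of [Y]. *)
Lemma lambda_compact : P X <-> compact_hausdorff Y.
Proof.
split=> [PX|[cY _]].
  split; last exact: lambda_locally_compact.2.
  have /C0P_lambda_extend[g C0g g1] := C0P_one (R := R) P_closed PX.
  have gE : g = fun=> 1.
    by apply: (dense_eq to_lambda_dense) => //; [exact: C0g.1|exact: CB_cst].
  have := C0g.2 1%N isT; rewrite (_ : level _ _ = setT)//.
  apply/seteqP; split=> // y _; rewrite /level /mkset gE normc1 invr1//.
apply: (C0P_one_prop (R := R)) => //.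
apply: (@C0_lambda_restrict (fun=> 1)); split; first exact: CB_cst.
move=> n n0; apply: (subclosed_compact _ cY) => //.
exact: closed_level (CB_cst 1).1.
Qed.

End Lambda.
Theorem theorem3p3p9 (R : realType) (P : topologicalType -> Prop)
    (P_top : topological_property P) (P_closed : closed_hereditary P)
    (P_fin : finite_closed_sums P) (X : topologicalType) :
  C0P R X P = [set f | CB R X f /\
                 forall n, (0 < n)%N -> P (set_type (level f n))] /\
  (countable_closed_sums P ->
     C0P R X P = [set f | CB R X f /\ P (set_type (coz f))]) /\
  (CB_closed_ideal (C0P R X P) /\ C00P R X P `<=` C0P R X P) /\
  (completely_regular X -> (non_vanishing (C0P R X P) <-> is_locally P X)) /\
  (completely_regular X -> is_locally P X -> (unital (C0P R X P) <-> P X)) /\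
  (completely_regular X -> is_locally P X ->
   let Y : topologicalType := set_type (lambdaP R X P) in
     CB_closed_ideal (C0P R X P) /\
     locally_compact_hausdorff Y /\
     isometrically_isomorphic (C0P R X P) (C0 R Y) /\
     (forall Z : topologicalType, locally_compact_hausdorff Z ->
        isometrically_isomorphic (C0P R X P) (C0 R Z) -> homeomorphic Y Z) /\
     homeomorphic Y (spectrum (C0P R X P)) /\
     (exists i : X -> Y, [/\ forall x, val (i x) = to_stone_cech R x,
                             embedding i & dense (range i)]) /\
     C0P R X P `<=` CB_closure (C00P R X P) /\
     ((unital (C0P R X P) <-> P X) /\ (P X <-> compact_hausdorff Y))).

Proof.
split; first exact: C0PE.
split; first exact: C0P_cozE.
split; first by split; [exact: C0P_closed_ideal|exact: C00P_sub].
split; first exact: C0P_non_vanishing.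
split; first exact: C0P_unital.
move=> crX locP Y.
have C0PI := C0P_closed_ideal (R := R) P_top P_closed P_fin (X := X).
have lchY : locally_compact_hausdorff Y by exact: lambda_locally_compact.
have isoY := C0P_lambda_iso (R := R) P_top P_closed P_fin crX locP.
have specY : homeomorphic Y (spectrum (C0P R X P)).
  apply: homeomorphic_trans (spectrum_C0 lchY) _.
  exact/homeomorphic_sym/(spectrum_iso C0PI.1 isoY).
split; first exact: C0PI.
split; first exact: lchY.
split; first exact: isoY.
split.
  move=> Z lchZ isoZ; apply: homeomorphic_trans specY _.
  apply: homeomorphic_trans (spectrum_iso C0PI.1 isoZ) _.
  exact/homeomorphic_sym/spectrum_C0.
split; first exact: specY.
split.
  exists (to_lambda P_top P_closed crX locP); split=> //.
  - exact: to_lambda_embedding.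
  - exact: to_lambda_dense.
split; first exact: C00P_dense.
by split; [exact: C0P_unital|exact: lambda_compact].
Qed.
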